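(* Let $d\ge1$. For every $\phi\in\overline{\mathbb{R}}^{d+1}$, $$Y\sim C_d^*(\phi)\ \Longrightarrow\ \mathcal{P}(Y)\sim C_d\{\mathcal{P}(\phi)\}.$$ Equivalently, for every $\theta\in(\mathbb{R}^d+i\mathbb{R})\cup\{\infty\}$, $$X\sim C_d(\theta)\ \Longrightarrow\ \mathcal{P}^{-1}(X)\sim C_d^*\{\mathcal{P}^{-1}(\theta)\}.$$
   Context: $S^d=\{x\in\mathbb{R}^{d+1}:\|x\|=1\}$; $\overline{\mathbb{R}}^{m}=\mathbb{R}^{m}\cup\{\infty\}$; $e_{d+1}$ is the $(d+1)$-th standard unit vector of $\mathbb{R}^{d+1}$. Spherical Cauchy distribution: for $\phi\in\mathbb{R}^{d+1}\setminus S^d$, $Y\sim C_d^*(\phi)$ means that the $S^d$-valued random vector $Y$ has density, with respect to surface area on $S^d$, $$f(y;\phi)=\frac{\Gamma\{(d+1)/2\}}{2\pi^{(d+1)/2}}\left(\frac{|1-\|\phi\|^2|}{\|y-\phi\|^2}\right)^d,\quad y\in S^d.$$ For $\phi\in S^d$, $C_d^*(\phi)$ is the point mass at $\phi$; $C_d^*(\infty)$ is the uniform distribution on $S^d$. Extended complex numbers: $\mathbb{R}^d+i\mathbb{R}$ is the set of formal expressions $\theta=\mu+i\sigma$ with $\mu\in\mathbb{R}^d$, $\sigma\in\mathbb{R}$; when $\sigma=0$, $\mu+i\sigma$ is identified with $\mu\in\mathbb{R}^d$. Extended stereographic projection: $\mathcal{P}:\overline{\mathbb{R}}^{d+1}\to(\mathbb{R}^d+i\mathbb{R})\cup\{\infty\}$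 is $$\mathcal{P}(x)=2\frac{(x_1,\ldots,x_d)^T}{\|x-e_{d+1}\|^2}+i\,\frac{1-\|x\|^2}{\|x-e_{d+1}\|^2},\quad x\in\mathbb{R}^{d+1}\setminus\{e_{d+1}\},$$ with $\mathcal{P}(\infty)=-i$ and $\mathcal{P}(e_{d+1})=\infty$. It is a bijection with inverse $$\mathcal{P}^{-1}(\theta)=\frac{2}{\|\mu\|^2+(1+\sigma)^2}\left(\mu^T,\frac{\|\mu\|^2+\sigma^2-1}{2}\right)^T,\quad \theta=\mu+i\sigma\ne -i,$$ $\mathcal{P}^{-1}(-i)=\infty$, $\mathcal{P}^{-1}(\infty)=e_{d+1}$. On $S^d$ it takes values in $\overline{\mathbb{R}}^d$. $C_d(\theta)$, for $\theta=\mu+i\sigma$ with $\mu\in\mathbb{R}^d$, $\sigma\neq0$, denotes the $d$-variate $t$-distribution with $d$ degrees of freedom with density (with respect to Lebesgue measure on $\mathbb{R}^d$) $$f(x;\theta)=\frac{2^{d-1}\Gamma\{(d+1)/2\}}{\pi^{(d+1)/2}}\left(\frac{|\sigma|}{\sigma^2+\|x-\mu\|^2}\right)^d.$$ For $\sigma=0$ it is the point mass at $\mu$, and for $\theta=\infty$ it is the point mass at $\infty$. *)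

(* Defs.v *)
From HB Require Import structures.
From mathcomp Require Import all_boot all_order all_algebra.
From mathcomp Require Import all_classical all_reals all_analysis.
From mathcomp Require Import measurable_realfun.

Set Implicit Arguments.
Unset Strict Implicit.
Unset Printing Implicit Defensive.

Import Order.TTheory GRing.Theory Num.Theory.
Import numFieldNormedType.Exports.

Local Open Scope classical_set_scope.
Local Open Scope ring_scope.

(* [`|x|] on ['rV[R]_n] is the sup norm, hence a separate Euclidean norm. *)
Definition enorm (R : realType) (n : nat) (x : 'rV[R]_n) : R :=
  Num.sqrt (\sum_(i < n) x 0 i ^+ 2).

Definition sphere (R : realType) (n : nat) : set 'rV[R]_n :=
  [set x | enorm x = 1].

(* R^n carries the sigma-algebra generated by the coordinates, as the library
   does for [n.-tuple R]; this is the Borel sigma-algebra. *)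
Fact rV_display : measure_display. Proof. exact: default_measure_display. Qed.

Section rV_measurable.
Context (R : realType) (n : nat).

Definition rV_coord (i : 'I_n) (x : 'rV[R]_n) : R := x 0 i.

HB.instance Definition _ := Pointed.on 'rV[R]_n.
HB.instance Definition _ :=
  @isMeasurable.Build rV_display 'rV[R]_n (g_sigma_preimage rV_coord)
    (@sigma_algebra0 _ _ _) (@sigma_algebraC _ _) (@sigma_algebra_bigcup _ _ _).

Lemma measurable_rV_coord (i : 'I_n) :
  measurable_fun [set: 'rV[R]_n] (rV_coord i).
Proof.
move=> _ Y mY; rewrite setTI; apply: sub_sigma_algebra => /=.
rewrite -bigcup_seq/=; exists i => /=; first by rewrite mem_index_enum.
by exists Y => //; rewrite setTI.
Qed.

Lemma measurable_fun_rV d (T : measurableType d) (f : T -> 'rV[R]_n) :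
  (forall i, measurable_fun [set: T] (rV_coord i \o f)) ->
  measurable_fun [set: T] f.
Proof.
move=> mf _ Y; rewrite setTI => mY.
pose G := [set B : set 'rV[R]_n | measurable (f @^-1` B)].
have : g_sigma_preimage rV_coord `<=` G.
  apply: smallest_sub.
    split => [|A GA|F GF]; rewrite /G /=.
    - by rewrite preimage_set0.
    - by rewrite setTD preimage_setC; exact: measurableC.
    - by rewrite preimage_bigcup; exact: bigcupT_measurable.
  rewrite -bigcup_seq => _ [i _ [B mB <-]]; rewrite /G /= setTI.
  by rewrite -comp_preimage -[X in measurable X]setTI; exact: mf.
exact.
Qed.

Lemma measurable_enorm :
  measurable_fun [set: 'rV[R]_n] (@enorm R n).
Proof.
apply: measurableT_comp.
  by apply: continuous_measurable_fun; exact: sqrt_continuous.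
apply: measurable_sum => i; apply: measurable_funX.
exact: (measurable_rV_coord i).
Qed.

End rV_measurable.

(* The sigma-algebra of the extension of T by a point at infinity [None]. For
   T = R^m it is the Borel sigma-algebra of the one-point compactification. *)
Fact ext_display : measure_display -> measure_display. Proof. exact. Qed.

Section ext_measurable.
Context d (T : measurableType d).

Definition ext_measurable : set (set (option T)) :=
  [set A | measurable (Some @^-1` A)].

Lemma ext_measurable0 : ext_measurable set0.
Proof. by rewrite /ext_measurable /= preimage_set0. Qed.

Lemma ext_measurableC A : ext_measurable A -> ext_measurable (~` A).
Proof. by move=> mA; rewrite /ext_measurable /= preimage_setC; exact: measurableC. Qed.

Lemma ext_measurable_bigcup (F : (set (option T))^nat) :
  (forall i, ext_measurable (F i)) -> ext_measurable (\bigcup_i F i).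
Proof.
by move=> mF; rewrite /ext_measurable /= preimage_bigcup; exact: bigcupT_measurable.
Qed.

HB.instance Definition _ := Pointed.on (option T).
HB.instance Definition _ :=
  @isMeasurable.Build (ext_display d) (option T) ext_measurable
    ext_measurable0 ext_measurableC ext_measurable_bigcup.

End ext_measurable.

Section image_measure.
Context d d' (T1 : measurableType d) (T2 : measurableType d') (R : realType).
Context (m : {measure set T1 -> \bar R}) (f : T1 -> T2).

(* [pushforward m f], with the measure structure that [mf] gives it. *)
Definition image_measure (mf : measurable_fun [set: T1] f) :
    {measure set T2 -> \bar R} :=
  measure_function_pushforward__canonical__measure_function_Measure m mf.

End image_measure.

(* (v_1, ..., v_n, t) *)
Definition row_snoc (R : realType) (n : nat) (v : 'rV[R]_n) (t : R) :
    'rV[R]_n.+1 :=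
  \row_i (if unlift ord_max i is Some j then v 0 j else t).

Section lebesgue_rV.
Context (R : realType).

Let snoc_pair n (p : 'rV[R]_n * measurableTypeR R) : 'rV[R]_n.+1 :=
  row_snoc p.1 p.2.

Lemma measurable_row_snoc n : measurable_fun [set: _] (@snoc_pair n).
Proof.
apply: measurable_fun_rV => i; rewrite /snoc_pair /comp /rV_coord.
under eq_fun do rewrite mxE.
case: (unlift ord_max i) => [j|]; last exact: measurable_snd.
exact: (measurableT_comp (measurable_rV_coord j) measurable_fst).
Qed.

(* Lebesgue measure on R^n, as the n-fold product of Lebesgue measure on R
   (for n = 0, the unit mass at the only point). *)
Fixpoint lebesgue_rV (n : nat) : {measure set 'rV[R]_n -> \bar R} :=
  if n is m.+1 then
    image_measure (lebesgue_rV m \x lebesgue_measure)%E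
      (@measurable_row_snoc m)
  else \d_(0 : 'rV[R]_0).

End lebesgue_rV.

Section surface_area.
Context (R : realType) (n : nat).

Definition punctured_ball : set 'rV[R]_n := [set x | 0 < enorm x <= 1].

Definition direction (x : 'rV[R]_n) : 'rV[R]_n := (enorm x)^-1 *: x.

Lemma measurable_punctured_ball : measurable punctured_ball.
Proof.
have -> : punctured_ball =
    [set: _] `&` ((@enorm R n) @^-1` `]0, 1]).
  by rewrite setTI; apply/seteqP; split=> x; rewrite /punctured_ball /= in_itv.
exact: (measurable_enorm _ (measurable_itv _)).
Qed.

Lemma measurable_direction : measurable_fun [set: _] direction.
Proof.
apply: measurable_fun_rV => i; rewrite /comp /direction /rV_coord.
under eq_fun do rewrite mxE.
apply: measurable_funM; last exact: (measurable_rV_coord i).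
under eq_fun do rewrite -powR_inv1 ?sqrtr_ge0//.
exact: (measurableT_comp (measurable_powR _) (@measurable_enorm R n)).
Qed.

(* Surface area on the unit sphere of R^n, as a measure on R^n that vanishes
   off the sphere: the area of a set A of unit vectors is n times the volume of
   the solid cone { r y | 0 < r <= 1, y in A }, which is the set of the x in
   the punctured unit ball with x / ||x|| in A. *)
Definition surface_area : {measure set 'rV[R]_n -> \bar R} :=
  mscale (n%:R)%:nng
    (image_measure (mrestr (@lebesgue_rV R n) measurable_punctured_ball)
       measurable_direction).

End surface_area.

Definition Gamma (R : realType) (a : R) : R :=
  \int[lebesgue_measure]_(t in `]0, +oo[) (t `^ (a - 1) * expR (- t)).

(* [extR R m] is R^m with the point [None] at infinity. *)
Notation extR R m := (option 'rV[R]_m).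

(* [Some (mu, sigma)] is mu + i sigma; [None] is infinity. A real vector mu is
   identified with [Some (mu, 0)]. *)
Notation extC R d := (option ('rV[R]_d * R)).

Definition in_sphere (R : realType) (m : nat) : set (extR R m) :=
  Some @` @sphere R m.

Definition in_extR (R : realType) (d : nat) : set (extC R d) :=
  [set z | if z is Some (_, s) then s = 0 else True].

Definition north (R : realType) (d : nat) : 'rV[R]_d.+1 := delta_mx 0 ord_max.

(* [col' ord_max x] is (x_1, ..., x_d). *)
Definition stereo (R : realType) (d : nat) (z : extR R d.+1) : extC R d :=
  match z with
  | None => Some (0, -1)
  | Some x =>
      if x == north R d then None
      else Some ((2 / enorm (x - north R d) ^+ 2) *: col' ord_max x,
                 (1 - enorm x ^+ 2) / enorm (x - north R d) ^+ 2)
  end.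

Definition stereo_inv (R : realType) (d : nat) (th : extC R d) : extR R d.+1 :=
  match th with
  | None => Some (north R d)
  | Some (mu, s) =>
      if (mu == 0) && (s == -1) then None
      else Some ((2 / (enorm mu ^+ 2 + (1 + s) ^+ 2)) *:
                 row_snoc mu ((enorm mu ^+ 2 + s ^+ 2 - 1) / 2))
  end.

Definition sphcauchy_pdf (R : realType) (d : nat) (phi y : 'rV[R]_d.+1) : R :=
  Gamma (d.+1%:R / 2) / (2 * pi `^ (d.+1%:R / 2)) *
  (`|1 - enorm phi ^+ 2| / enorm (y - phi) ^+ 2) ^+ d.

(* Laws of S^d-valued variables, as measures on the extended space. *)
Definition sphcauchy (R : realType) (d : nat) (phi : extR R d.+1)
    (A : set (extR R d.+1)) : \bar R :=
  match phi with
  | None =>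
      ((fine (surface_area R d.+1 (@sphere R d.+1)))^-1%R%:E *
       surface_area R d.+1 (@sphere R d.+1 `&` Some @^-1` A))%E
  | Some v =>
      if enorm v == 1 then \d_(Some v : extR R d.+1) A
      else (\int[surface_area R d.+1]_(y in @sphere R d.+1 `&` Some @^-1` A)
              (sphcauchy_pdf v y)%:E)%E
  end.

Definition tcauchy_pdf (R : realType) (d : nat) (mu : 'rV[R]_d) (s : R)
    (x : 'rV[R]_d) : R :=
  2 ^+ d.-1 * Gamma (d.+1%:R / 2) / pi `^ (d.+1%:R / 2) *
  (`|s| / (s ^+ 2 + enorm (x - mu) ^+ 2)) ^+ d.

(* Laws of variables with values in R^d extended by infinity, as measures on
   the extended complex space, through the identification above. *)
Definition tcauchy (R : realType) (d : nat) (th : extC R d)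
    (A : set (extC R d)) : \bar R :=
  match th with
  | None => \d_(None : extC R d) A
  | Some (mu, s) =>
      if s == 0 then
        \d_(Some (mu, 0) : extC R d) A
      else (\int[lebesgue_rV R d]_(x in [set x | A (Some (x, 0%R))])
              (tcauchy_pdf mu s x)%:E)%E
  end.

(* X is an S-valued random element with law mu. *)
Definition has_law d d' (T : measurableType d) (T' : measurableType d')
    (R : realType) (P : probability T R) (X : T -> T') (S : set T')
    (mu : set T' -> \bar R) : Prop :=
  [/\ measurable_fun [set: T] X,
      forall w, S (X w) &
      forall A, measurable A -> pushforward P X A = mu A].

Definition dist_sphcauchy dT (T : measurableType dT) (R : realType)
    (P : probability T R) (d : nat) (Y : T -> extR R d.+1)
    (phi : extR R d.+1) : Prop :=
  has_law P Y (@in_sphere R d.+1) (sphcauchy phi).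

Definition dist_tcauchy dT (T : measurableType dT) (R : realType)
    (P : probability T R) (d : nat) (X : T -> extC R d)
    (th : extC R d) : Prop :=
  has_law P X (@in_extR R d)
    (tcauchy th).

(* Main.v *)
(* Write y in R^{d+1} as (v, h). For fixed v <> 0, the variable s = |y| - h runs
   over (0, oo), with h = (|v|^2 / s - s) / 2; putting v = s x and then
   s = 2 r / (1 + |x|^2) gives y = r q(x), where q is the inverse stereographic
   projection, so Lebesgue measure disintegrates as
   dy = r^d dr (2 / (1 + |x|^2))^d dx. Hence q transports the density
   (2 / (1 + |x|^2))^d to surface area on S^d; integrating exp(-|y|^2) both ways
   gives the area of S^d, which normalizes the case phi = oo. For finite phi off
   the sphere the two densities correspond by
   D (1 + |x|^2) |q(x) - phi|^2 = (1 - |phi|^2)^2 + |D x - 2 phi'|^2, where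
   phi' is the vector of the first d coordinates of phi and
   D = |phi - e_{d+1}|^2. *)
From HB Require Import structures.
Require Import Defs.
From mathcomp Require Import all_boot all_order all_algebra.
From mathcomp Require Import all_classical all_reals all_analysis.
From mathcomp Require Import measurable_realfun ring lra.

Set Implicit Arguments.
Unset Strict Implicit.
Unset Printing Implicit Defensive.
Import Order.TTheory GRing.Theory Num.Theory.
Import numFieldNormedType.Exports.
Local Open Scope classical_set_scope.
Local Open Scope ring_scope.

(** * Images of measures given by a density, and integration against them *)

Section density_image.
Local Open Scope ereal_scope.
Context d d' (X : measurableType d) (Y : measurableType d') (R : realType).
Variables (mu : {measure set X -> \bar R}) (phi : X -> Y) (w : X -> R).
Variables (D : set X) (mD : measurable D).
Hypothesis mphi : measurable_fun [set: X] phi.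
Hypothesis mw : measurable_fun D w.
Hypothesis w0 : forall x, D x -> (0 <= w x)%R.

(** The image under [phi] of the measure that has density [w] with respect to [mu] on [D]. *)
Definition density_image (A : set Y) : \bar R :=
  \int[mu]_(x in D `&` phi @^-1` A) (w x)%:E.

Lemma measurable_density_image_dom (A : set Y) :
  measurable A -> measurable (D `&` phi @^-1` A).
Proof.
by move=> mA; apply: measurableI => //; rewrite -[X in measurable X]setTI; exact: mphi.
Qed.

Let density_image0 : density_image set0 = 0.
Proof. by rewrite /density_image preimage_set0 setI0 integral_set0. Qed.

Let density_image_ge0 A : 0 <= density_image A.
Proof. by apply: integral_ge0 => x [Dx _]; rewrite lee_fin w0. Qed.

Let density_image_sigma_additive : semi_sigma_additive density_image.
Proof.
move=> F mF tF mUF.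
rewrite /density_image preimage_bigcup setI_bigcupr ge0_integral_bigcup//=.
- by apply: is_cvg_ereal_nneg_natsum_cond => n _ _; exact: density_image_ge0.
- by move=> k; exact: measurable_density_image_dom.
- by apply/measurable_EFinP; apply: measurable_funS mw => //; apply: bigcup_sub => k _ x [].
- by move=> x [k _ [Dx _]]; rewrite lee_fin w0.
- apply/trivIsetP => i j _ _ ij; move/trivIsetP : tF => /(_ i j Logic.I Logic.I ij).
  move=> FF; rewrite setIACA -preimage_setI FF preimage_set0 setI0//.
Qed.

HB.instance Definition _ := isMeasure.Build _ _ _
  density_image density_image0 density_image_ge0 density_image_sigma_additive.

Definition density_measure : {measure set Y -> \bar R} := density_image.

Import HBNNSimple.

(** Split [f] into its level sets: on each, both sides become the value of [f] times the integral of
    [w] over the part of [D] that [phi] sends into the level set. *)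
Lemma nnsfun_integral_density_measure (f : {nnsfun Y >-> R}) :
  \int[density_measure]_y (f y)%:E = \int[mu]_(x in D) ((f (phi x))%:E * (w x)%:E).
Proof.
have mf k : measurable (f @^-1` [set k]) by [].
under eq_integral do rewrite fimfunE -fsumEFin//.
rewrite ge0_integral_fsum//; last 2 first.
- by move=> y; exact/measurable_EFinP/measurable_funM.
- by move=> y x _; rewrite nnfun_muleindic_ge0.
transitivity (\sum_(k \in range f) \int[mu]_(x in D)
    (k%:E * ((\1_(phi @^-1` (f @^-1` [set k])) x)%:E * (w x)%:E))); last first.
  rewrite -ge0_integral_fsum//; last 2 first.
  - move=> k; apply: measurable_funeM; apply: emeasurable_funM; last exact/measurable_EFinP.
    apply/measurable_EFinP/measurable_funTS/measurable_indic.
    by rewrite -[X in measurable X]setTI; exact: mphi.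
  - move=> k x Dx; rewrite muleA mule_ge0 ?lee_fin ?w0//.
    by have := nnfun_muleindic_ge0 f k (phi x); rewrite lee_fin.
  apply: eq_integral => x /[!inE] Dx; rewrite fimfunE -fsumEFin//.
  rewrite ge0_mule_fsuml; last by move=> k; rewrite nnfun_muleindic_ge0.
  by apply: eq_fsbigr => k _; rewrite muleA EFinM.
apply: eq_fsbigr => k _.
rewrite integralZl_indic_nnsfun// integral_indic// setIT.
have [k0|k0] := ltP k 0%R.
  rewrite preimage_nnfun0// preimage_set0 measure0 mule0.
  rewrite integral0_eq// => x _; rewrite indic0 mul0e mule0//.
rewrite ge0_integralZl//; last 2 first.
- apply: emeasurable_funM; last exact/measurable_EFinP.
  apply/measurable_EFinP/measurable_funTS/measurable_indic.
  by rewrite -[X in measurable X]setTI; exact: mphi.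
- by move=> x Dx; rewrite mule_ge0// lee_fin// w0.
congr (_ * _); rewrite [LHS]integral_mkcondr; apply: eq_integral => x Dx.
by rewrite epatch_indic muleC//.
Qed.

(** Monotone convergence extends the formula from the simple functions increasing to [F]. *)
Lemma ge0_integral_density_measure (F : Y -> \bar R) :
  measurable_fun [set: Y] F -> (forall y, 0 <= F y) ->
  \int[density_measure]_y F y = \int[mu]_(x in D) (F (phi x) * (w x)%:E).
Proof.
move=> mF F0; pose f_ := nnsfun_approx measurableT mF.
have cvgf y : EFin \o f_ ^~ y @ \oo --> F y by exact: cvg_nnsfun_approx.
transitivity (limn (fun n => \int[density_measure]_y (f_ n y)%:E)).
  rewrite -monotone_convergence//.
  - apply: eq_integral => y _; apply/esym/cvg_lim => //; exact: cvgf.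
  - by move=> n; exact/measurable_EFinP.
  - by move=> n y _; rewrite lee_fin.
  - by move=> y _ m n mn; rewrite lee_fin; exact/lefP/nd_nnsfun_approx.
under eq_fun do rewrite nnsfun_integral_density_measure.
rewrite -monotone_convergence//; last 3 first.
- move=> n; apply: emeasurable_funM; last exact/measurable_EFinP.
  by apply/measurable_EFinP/measurable_funTS/measurableT_comp.
- by move=> n x Dx; rewrite mule_ge0// lee_fin// w0.
- move=> x Dx m n mn; rewrite lee_wpmul2r ?lee_fin ?w0//.
  exact/lefP/nd_nnsfun_approx.
apply: eq_integral => x /[!inE] Dx.
apply/cvg_lim => //; apply: cvgeZr => //; exact: cvgf.
Qed.

(** Reduces a change of variables to the comparison of two measures on measurable sets. *)
Lemma ge0_integral_cov (nu : {measure set Y -> \bar R}) (F : Y -> \bar R) :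
  (forall A, measurable A -> nu A = density_image A) ->
  measurable_fun [set: Y] F -> (forall y, 0 <= F y) ->
  \int[nu]_y F y = \int[mu]_(x in D) (F (phi x) * (w x)%:E).
Proof.
move=> nuE mF F0; rewrite -ge0_integral_density_measure//.
by apply: eq_measure_integral => A mA _; exact: nuE.
Qed.

End density_image.

(** * Changes of variables on the line *)

Section lebesgue_change_of_variables.
Context (R : realType).
Notation mu := (@lebesgue_measure R).
Local Open Scope ereal_scope.

(** Lebesgue measure is determined by the lengths of the intervals []a, b]], so the image measure
    has to be computed on these alone. *)
Lemma ge0_integral_lebesgue_cov (phi w : R -> R) (D : set R) (F : R -> \bar R) :
  measurable D -> measurable_fun [set: R] phi -> measurable_fun D w ->
  (forall x, D x -> (0 <= w x)%R) ->
  (forall a b : R, (a < b)%R ->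
    \int[mu]_(x in D `&` phi @^-1` `]a, b]) (w x)%:E = (b - a)%:E) ->
  measurable_fun [set: R] F -> (forall y, 0 <= F y) ->
  \int[mu]_y F y = \int[mu]_(x in D) (F (phi x) * (w x)%:E).
Proof.
move=> mD mphi mw w0 wE mF F0.
apply: (@ge0_integral_cov _ _ (measurableTypeR R) (measurableTypeR R)) => // A mA.
apply: (@lebesgue_measure_unique R (@density_measure _ _ (measurableTypeR R)
  (measurableTypeR R) R mu phi w D mD mphi mw w0)) => // _ [[a b] _ <-].
rewrite lebesgue_measure_itv/= lte_fin; case: ifPn => ab.
  by rewrite [RHS]wE// EFinB.
by rewrite set_itv_ge ?measure0// bnd_simp.
Qed.

Lemma ge0_integral_lebesgue_scale (c : R) (F : R -> \bar R) : (0 < c)%R ->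
  measurable_fun [set: R] F -> (forall y, 0 <= F y) ->
  \int[mu]_y F y = \int[mu]_x (F (c * x)%R * c%:E).
Proof.
move=> c0 mF F0.
apply: (@ge0_integral_lebesgue_cov ( *%R c) (cst c)) => //.
- by move=> *; rewrite ltW.
move=> a b ab; rewrite setTI.
have -> : *%R c @^-1` `]a, b] = `](c^-1 * a)%R, (c^-1 * b)%R]%classic.
  apply/seteqP; split => x /=; rewrite !in_itv/= ltr_pdivrMl// ler_pdivlMl//.
rewrite (eq_integral (cst c%:E))// integral_cst//=.
rewrite lebesgue_measure_itv/= lte_fin ltr_pM2l ?invr_gt0// ab -EFinB -EFinM.
by rewrite -mulrBr mulrA divff ?mul1r// gt_eqF.
Qed.

Lemma integral_FTC_pos (w G : R -> R) (a b : R) : (0 < a < b)%R ->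
  (forall x : R, (0 < x)%R -> is_derive x 1%R G (w x)) ->
  (forall x : R, (0 < x)%R -> {for x, continuous w}) ->
  \int[mu]_(x in `[a, b]) (w x)%:E = (G b - G a)%:E.
Proof.
move=> /andP[a0 ab] dG cw; rewrite EFinB; apply: continuous_FTC2 => //.
- apply: continuous_in_subspaceT => x; rewrite inE/= in_itv/= => /andP[ax _].
  exact/cw/(lt_le_trans a0).
- have cG (x : R) : (0 < x)%R -> {for x, continuous G}.
    by move=> x0; apply/differentiable_continuous/derivable1_diffP; case: (dG x x0).
  split => [x /[!in_itv]/= /andP[ax _]| |].
  + by case: (dG x (lt_trans a0 ax)).
  + exact/cvg_at_right_filter/cG.
  + exact/cvg_at_left_filter/cG/(lt_trans a0).
- move=> x /[!in_itv]/= /andP[ax _].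
  by rewrite derive1E; case: (dG x (lt_trans a0 ax)).
Qed.

(** Real powers are measurable, and $x^{-1} = x (x^2)^{-1}$ holds also at 0, where the inverse is 0
    by convention. *)
Lemma measurable_inv : measurable_fun [set: R] (@GRing.inv R).
Proof.
have -> : @GRing.inv R = (fun x => x * (x ^+ 2) `^ (-1))%R.
  apply/funext => x; rewrite powR_inv1 ?sqr_ge0//.
  by have [->|x0] := eqVneq x 0%R; rewrite ?invr0 ?mul0r// expr2 invfM mulVKf.
apply: measurable_funM => //; apply: (measurableT_comp (measurable_powR _)).
exact: measurable_funX.
Qed.

(** As [phi] decreases on the positive half-line with inverse [psi], it pulls []a, b]] back to [[psi
    b, psi a[]; there [- phi] is an antiderivative of [w], so the integral of [w] is $b - a$. *)
Lemma ge0_integral_lebesgue_decreasing (phi psi w : R -> R) (F : R -> \bar R) :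
  measurable_fun [set: R] phi -> measurable_fun [set: R] w ->
  (forall x : R, (0 < x)%R -> (0 <= w x)%R) ->
  (forall x : R, (0 < x)%R -> is_derive x 1%R phi (- w x)%R) ->
  (forall x : R, (0 < x)%R -> {for x, continuous w}) ->
  (forall x y : R, (0 < x)%R -> (x < y)%R -> (phi y < phi x)%R) ->
  (forall h, (0 < psi h)%R) -> cancel psi phi ->
  measurable_fun [set: R] F -> (forall y, 0 <= F y) ->
  \int[mu]_y F y = \int[mu]_(x in `]0%R, +oo[) (F (phi x) * (w x)%:E).
Proof.
move=> mphi mw w0 dphi cw phi_decr psi0 psiK mF F0.
have leP (x h : R) : (0 < x)%R -> (phi x <= h)%R = (psi h <= x)%R.
  move=> x0; rewrite -{1}(psiK h); case: (ltgtP x (psi h)) => [||->].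
  - by move/(phi_decr _ _ x0); rewrite ltNge => /negbTE.
  - by move/(phi_decr _ _ (psi0 h))/ltW.
  - by rewrite lexx.
apply: ge0_integral_lebesgue_cov => //.
- exact: measurable_funTS.
- by move=> x /=; rewrite in_itv/= andbT; exact: w0.
move=> a b ab.
have -> : `]0%R, +oo[ `&` phi @^-1` `]a, b] = `[psi b, psi a[%classic.
  apply/seteqP; split => x /=; rewrite !in_itv/= andbT.
    by move=> [x0]; rewrite leP// ltNge leP// -ltNge => /andP[-> ->].
  move=> /andP[bx xa]; have x0 : (0 < x)%R := lt_le_trans (psi0 b) bx.
  by rewrite x0 leP// bx ltNge leP// -ltNge xa.
have ba : (psi b < psi a)%R.
  by rewrite ltNge -leP// psiK -ltNge.
(* Adding the right endpoint changes nothing and gives the closed interval of the fundamental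
   theorem. *)
rewrite integral_itv_bndo_bndc; last first.
  exact/measurable_EFinP/measurable_funTS.
have dN (x : R) : (0 < x)%R -> is_derive x 1%R (fun x => - phi x)%R (w x).
  by move=> x0; have := is_deriveN (dphi _ x0); rewrite opprK.
rewrite (integral_FTC_pos _ dN cw) ?psi0//.
by rewrite !psiK opprK addrC.
Qed.

(** The substitution $h = (c/s - s)/2$, inverse to $s = \sqrt{c + h^2} - h$. With $c = |v|^2$ this
    $s$ is $|y| - h$ for $y = (v, h)$. *)
Lemma ge0_integral_lebesgue_hyperbolic (c : R) (F : R -> \bar R) : (0 < c)%R ->
  measurable_fun [set: R] F -> (forall y, 0 <= F y) ->
  \int[mu]_y F y =
  \int[mu]_(s in `]0%R, +oo[) (F ((c / s - s) / 2)%R * ((c / s ^+ 2 + 1) / 2)%:E).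
Proof.
move=> c0 mF F0.
apply: (@ge0_integral_lebesgue_decreasing (fun s => (c / s - s) / 2)%R
  (fun h => Num.sqrt (c + h ^+ 2) - h)%R (fun s => (c / s ^+ 2 + 1) / 2)%R) => //.
- apply: measurable_funM => //; apply: measurable_funB => //.
  by apply: measurable_funM => //; exact: measurable_inv.
- apply: measurable_funM => //; apply: measurable_funD => //.
  apply: measurable_funM => //; apply: (measurableT_comp measurable_inv).
  exact: measurable_funX.
- move=> x x0; rewrite divr_ge0// addr_ge0// divr_ge0 ?ltW// exprn_gt0//.
- move=> x x0; have x0' : x != 0%R by rewrite gt_eqF.
  have dV := is_deriveV (f := id) x0' (is_derive_id x 1%R).
  have := is_deriveZ 2^-1%R (is_deriveB (is_deriveZ c dV) (is_derive_id x 1%R)).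
  congr is_derive; last by rewrite /GRing.scale/= mulr1; ring.
  by apply/funext => s /=; rewrite /GRing.scale/= mulrC !fctE/=.
- move=> x x0; have x0' : x != 0%R by rewrite gt_eqF.
  apply: cvgM; last exact: cvg_cst.
  apply: cvgD; last exact: cvg_cst.
  apply: cvgM; first exact: cvg_cst.
  apply: cvgV; first by rewrite expf_neq0.
  exact: exprn_continuous.
- move=> x y x0 xy; rewrite ltr_pM2r ?invr_gt0// ltrB// ltr_pM2l// ltf_pV2// posrE//.
  exact: lt_trans xy.
- move=> h; rewrite subr_gt0; case: (lerP h 0%R) => h0.
    by rewrite (le_lt_trans h0)// sqrtr_gt0 ltr_wpDr// sqr_ge0.
  by rewrite -{1}(gtr0_norm h0) -sqrtr_sqr ltr_sqrt ?ltrDr// ltr_wpDr ?sqr_ge0.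
- move=> h; set r := Num.sqrt _; have r2 : (r ^+ 2 = c + h ^+ 2)%R.
    by rewrite sqr_sqrtr// addr_ge0 ?sqr_ge0// ltW.
  (* Since $c = (r-h)(r+h)$, dividing by $s = r - h$ gives $c/s = r + h$, so $(c/s - s)/2 = h$. *)
  have cE : (c = (r - h) * (r + h))%R.
    by rewrite -subr_sqr r2 addrK.
  have rh : (r - h != 0)%R.
    by apply: contraTneq c0 => rh; rewrite cE rh mul0r ltxx.
  by rewrite {1}cE mulrAC divff// mul1r; lra.
Qed.

(** The substitution $s = \exp(-h/c)$; the cases $c = 1$ and $c = 2$ will relate the Gamma integral
    to a radial Gaussian integral. *)
Lemma ge0_integral_lebesgue_ln (c : R) (F : R -> \bar R) : (0 < c)%R ->
  measurable_fun [set: R] F -> (forall y, 0 <= F y) ->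
  \int[mu]_y F y =
  \int[mu]_(s in `]0%R, +oo[) (F (- (c * ln s))%R * (c / s)%:E).
Proof.
move=> c0 mF F0.
apply: (@ge0_integral_lebesgue_decreasing (fun s => - (c * ln s))%R
  (fun h => expR (- h / c))%R (fun s => c / s)%R) => //.
- by apply: measurableT_comp => //; apply: measurable_funM => //; exact: measurable_ln.
- by apply: measurable_funM => //; exact: measurable_inv.
- by move=> x x0; rewrite divr_ge0// ltW.
- move=> x x0; exact: is_deriveN (is_deriveZ c (is_derive1_ln x0)).
- move=> x x0; apply: cvgM; first exact: cvg_cst.
  by apply: inv_continuous; rewrite gt_eqF.
- by move=> x y x0 xy; rewrite ltrN2 ltr_pM2l// ltr_ln// posrE; exact: lt_trans xy.
- by move=> h; rewrite expR_gt0.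
- by move=> h; rewrite expRK mulrC divfK ?opprK// gt_eqF.
Qed.

End lebesgue_change_of_variables.

(** * Lebesgue measure on R^n *)

Section row_snoc_theory.
Context (R : realType) (n : nat).
Implicit Types (v : 'rV[R]_n) (t : R) (x : 'rV[R]_n.+1).

Lemma row_snoc_max v t : row_snoc v t 0 ord_max = t.
Proof. by rewrite mxE unlift_none. Qed.

Lemma row_snoc_lift v t i : row_snoc v t 0 (lift ord_max i) = v 0 i.
Proof. by rewrite mxE liftK. Qed.

Lemma col'_row_snoc v t : col' ord_max (row_snoc v t) = v.
Proof. by apply/rowP => i; rewrite mxE row_snoc_lift. Qed.

Lemma row_snoc_col' x : row_snoc (col' ord_max x) (x 0 ord_max) = x.
Proof.
apply/rowP => i; rewrite mxE; case: unliftP => [j ->|->//].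
by rewrite mxE.
Qed.

Lemma scale_row_snoc (c : R) v t : c *: row_snoc v t = row_snoc (c *: v) (c * t).
Proof.
by apply/rowP => i; rewrite !mxE; case: (unlift _ _) => [j|//]; rewrite mxE.
Qed.

Lemma sub_row_snoc v t v' t' :
  row_snoc v t - row_snoc v' t' = row_snoc (v - v') (t - t').
Proof.
by apply/rowP => i; rewrite !mxE; case: (unlift _ _) => [j|//]; rewrite !mxE.
Qed.

Lemma sqr_enorm m (x : 'rV[R]_m) : enorm x ^+ 2 = \sum_i x 0 i ^+ 2.
Proof. by rewrite sqr_sqrtr// sumr_ge0// => i _; rewrite sqr_ge0. Qed.

Lemma enorm_ge0 m (x : 'rV[R]_m) : 0 <= enorm x.
Proof. exact: sqrtr_ge0. Qed.

Lemma enorm_eq0 m (x : 'rV[R]_m) : (enorm x == 0) = (x == 0).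
Proof.
rewrite -sqrf_eq0 sqr_enorm psumr_eq0; last by move=> i _; rewrite sqr_ge0.
apply/allP/eqP => [x0|-> i _]; last by rewrite /= mxE expr0n/= eqxx.
by apply/rowP => i; rewrite mxE; apply/eqP; rewrite -sqrf_eq0;
  exact: (implyP (x0 i (mem_index_enum i))).
Qed.

Lemma enormZ m (c : R) (x : 'rV[R]_m) : enorm (c *: x) = `|c| * enorm x.
Proof.
rewrite /enorm; under eq_bigr do rewrite mxE exprMn.
by rewrite -mulr_sumr sqrtrM ?sqr_ge0// sqrtr_sqr.
Qed.

Lemma sqr_enorm_row_snoc v t : enorm (row_snoc v t) ^+ 2 = enorm v ^+ 2 + t ^+ 2.
Proof.
rewrite !sqr_enorm (bigD1_ord ord_max)//= row_snoc_max addrC; congr (_ + _).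
by apply: eq_bigr => i _; rewrite row_snoc_lift.
Qed.

End row_snoc_theory.

Section lebesgue_rV_theory.
Context (R : realType).
Notation mu := (@lebesgue_measure R).
Local Open Scope ereal_scope.

(** Closed balls of natural radius exhaust the space. Their volumes are finite by induction on the
    dimension: a ball lies in the cylinder over a ball of the same radius, one dimension lower. *)
Lemma lebesgue_rV_sigma_finite n : sigma_finite [set: 'rV[R]_n] (@lebesgue_rV R n).
Proof.
have mB m (r : R) : measurable [set x : 'rV[R]_m | (enorm x <= r)%R].
  have -> : [set x : 'rV[R]_m | (enorm x <= r)%R] =
      [set: _] `&` (@enorm R m) @^-1` `]-oo, r].
    by rewrite setTI; apply/seteqP; split => x /=; rewrite in_itv.
  exact: (@measurable_enorm R m).
exists (fun k => [set x : 'rV[R]_n | enorm x <= k%:R]%R).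
  apply/seteqP; split => // x _; exists (Num.bound (enorm x)) => //=.
  by rewrite ltW// archi_boundP// enorm_ge0.
move=> k; split; first exact: mB.
elim: n => [|n ih].
  by rewrite /= diracE; case: (_ \in _); rewrite ?ltry.
pose B := [set x : 'rV[R]_n | (enorm x <= k%:R)%R] `*`
  ([set` `[- k%:R, k%:R]%R] : set (measurableTypeR R)).
have mBB : measurable B by apply: measurableX => //; exact: mB.
have le : lebesgue_rV R n.+1 [set x | (enorm x <= k%:R)%R] <=
    (lebesgue_rV R n \x mu) B.
  rewrite /= /pushforward le_measure ?inE//.
    rewrite -[X in measurable X]setTI; apply: measurable_row_snoc => //.
    exact: mB.
  move=> [v t] /= xk; have k0 : (0 <= k%:R :> R)%R by [].
  move: xk; rewrite -ler_sqr ?nnegrE ?enorm_ge0// sqr_enorm_row_snoc => vtk.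
  split => /=.
    rewrite -ler_sqr ?nnegrE ?enorm_ge0//; apply: le_trans vtk.
    by rewrite lerDl sqr_ge0.
  rewrite in_itv/= -ler_norml -ler_sqr ?nnegrE// real_normK ?num_real//.
  by apply: le_trans vtk; rewrite lerDr sqr_ge0.
apply: (le_lt_trans le).
rewrite /B product_measure1E//; last exact: mB.
rewrite lte_mul_pinfty// ?measure_ge0// ?ge0_fin_numE//.
suff: mu [set` `[(- k%:R)%R, k%:R]] < +oo by [].
by rewrite lebesgue_measure_itv/=; case: ifP => _; rewrite ?ltry// -EFinB ltry.
Qed.

(* The sigma-finite structure is declared on this alias because the head of
   [lebesgue_rV R n] is a bundled measure. *)
Definition lebesgue_rV_fun n : set 'rV[R]_n -> \bar R := lebesgue_rV R n.

HB.instance Definition _ n :=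
  Measure.copy (@lebesgue_rV_fun n) (lebesgue_rV R n : set _ -> \bar R).
HB.instance Definition _ n := Measure_isSigmaFinite.Build _ _ _
  (@lebesgue_rV_fun n) (@lebesgue_rV_sigma_finite n).

Definition lebesgue_rV_sf n : {sigma_finite_measure set 'rV[R]_n -> \bar R} :=
  @lebesgue_rV_fun n.

Lemma ge0_integral_rVS n (H : 'rV[R]_n.+1 -> \bar R) :
  measurable_fun [set: _] H -> (forall x, 0 <= H x) ->
  \int[lebesgue_rV R n.+1]_x H x =
  \int[lebesgue_rV R n]_v \int[mu]_t H (row_snoc v t).
Proof.
move=> mH H0.
rewrite (@ge0_integral_pushforward _ _ _ _ R _ (@measurable_row_snoc R n)
  _ [set: _] H)// preimage_setT.
rewrite (@fubini_tonelli1 _ _ _ _ R (lebesgue_rV_sf n) mu)//; last by move=> p; exact: H0.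
by apply: measurableT_comp mH _; exact: measurable_row_snoc.
Qed.

(** Tonelli's theorem, once the restriction to [D] is absorbed into the integrand as an
    indicator. *)
Lemma ge0_integral_rV_exchange n (D : set R) (H : 'rV[R]_n * R -> \bar R) :
  measurable D -> measurable_fun [set: _] H -> (forall x, 0 <= H x) ->
  \int[lebesgue_rV R n]_v \int[mu]_(t in D) H (v, t) =
  \int[mu]_(t in D) \int[lebesgue_rV R n]_v H (v, t).
Proof.
move=> mD mH H0.
pose H' p := H p * (\1_D p.2)%:E.
transitivity (\int[lebesgue_rV R n]_v \int[mu]_t H' (v, t)).
  apply: eq_integral => v _; rewrite integral_mkcond.
  by apply: eq_integral => t _; rewrite epatch_indic.
rewrite (@fubini_tonelli _ _ _ _ R (lebesgue_rV_sf n) mu H')//; last 2 first.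
- apply: emeasurable_funM => //; apply/measurable_EFinP.
  apply: (@measurableT_comp _ _ _ _ _ _ (\1_D : R -> R) _ (@snd 'rV[R]_n R)) => //.
- by move=> p; rewrite mule_ge0// lee_fin.
rewrite [RHS]integral_mkcond; apply: eq_integral => t _.
rewrite patchE; case: ifPn => tD.
  by apply: eq_integral => v _; rewrite /H'/= indicE tD mule1.
by apply: integral0_eq => v _; rewrite /H'/= indicE (negbTE tD) mule0.
Qed.

(** Induction on the dimension: the last coordinate contributes one factor [c], the others $c^n$. *)
Lemma ge0_integral_rV_scale n (c : R) (H : 'rV[R]_n -> \bar R) : (0 < c)%R ->
  measurable_fun [set: _] H -> (forall x, 0 <= H x) ->
  \int[lebesgue_rV R n]_x H x =
  \int[lebesgue_rV R n]_x (H (c *: x)%R * (c ^+ n)%:E).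
Proof.
move=> c0; elim: n H => [|n ih] H mH H0.
  apply: eq_integral => x _; rewrite expr0 mule1; congr H.
  by apply/rowP => -[].
have mc m : measurable_fun [set: 'rV[R]_m] ( *:%R c).
  apply: measurable_fun_rV => i; rewrite /comp /rV_coord.
  under eq_fun do rewrite mxE.
  by apply: measurable_funM => //; exact: measurable_rV_coord.
have mrow m (v : 'rV[R]_m) : measurable_fun [set: R] (fun t => row_snoc v t).
  apply: measurable_fun_rV => i; rewrite /comp /rV_coord.
  under eq_fun do rewrite mxE.
  by case: (unlift _ _) => [j|]; [exact: measurable_cst|exact: measurable_id].
have cn0 m : 0 <= (c ^+ m)%:E :> \bar R by rewrite lee_fin exprn_ge0// ltW.
rewrite ge0_integral_rVS// [RHS]ge0_integral_rVS//; last 2 first.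
- by apply: emeasurable_funM => //; exact: (measurableT_comp mH (mc _)).
- by move=> x; rewrite mule_ge0.
rewrite ih.
- apply: eq_integral => v _.
  rewrite (ge0_integral_lebesgue_scale c0)//; last exact: (measurableT_comp mH (mrow _ _)).
  rewrite -ge0_integralZr//.
  + by apply: eq_integral => t _; rewrite scale_row_snoc -muleA exprS EFinM.
  + apply: emeasurable_funM => //.
    apply: (measurableT_comp (measurableT_comp mH (mrow _ (c *: v)%R))).
    exact: mulrl_measurable.
  + by move=> t _; rewrite mule_ge0// lee_fin ltW.
- apply: (@measurable_fun_fubini_tonelli_F _ _ _ _ R mu
    (fun p => H (row_snoc p.1 p.2))) => //.
  exact: (measurableT_comp mH (@measurable_row_snoc R n)).
- by move=> v; exact: integral_ge0.
Qed.

Lemma measurable_rV_set0 n : measurable [set 0%R : 'rV[R]_n].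
Proof.
have -> : [set 0%R : 'rV[R]_n] = [set: _] `&` (@enorm R n) @^-1` [set 0%R].
  rewrite setTI; apply/seteqP; split => x /=; first by move=> ->; apply/eqP; rewrite enorm_eq0.
  by move/eqP; rewrite enorm_eq0 => /eqP.
exact: measurable_enorm.
Qed.

(** The inner integral over the last coordinate sees at most the point $t = 0$. This lets the polar
    formula discard $v = 0$. *)
Lemma lebesgue_rV_set0 n : lebesgue_rV R n.+1 [set 0%R] = 0.
Proof.
have m0 := @measurable_rV_set0 n.+1.
rewrite -[X in lebesgue_rV R _ X]setIT -(@integral_indic _ _ R (lebesgue_rV R n.+1))//.
rewrite ge0_integral_rVS//; last first.
  by apply/measurable_EFinP; exact: measurable_indic.
apply: integral0_eq => v _.
rewrite [LHS](_ : _ = \int[mu]_(t in [set 0%R]) (\1_[set 0%R] (row_snoc v t))%:E).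
  exact: integral_set1.
rewrite [RHS]integral_mkcond; apply: eq_integral => t _.
rewrite patchE; case: ifPn => // t0; rewrite indicE; case: (_ \in _) / boolP => //.
rewrite inE/= => v0; move/negP: t0; rewrite inE/= => -[].
by rewrite -(row_snoc_max v t) v0 mxE.
Qed.

End lebesgue_rV_theory.

(** * Polar coordinates and surface area *)

Section polar_coordinates.
Context (R : realType).
Notation mu := (@lebesgue_measure R).
Local Open Scope ereal_scope.

Lemma ge0_integral_pos_scale (c : R) (F : R -> \bar R) : (0 < c)%R ->
  measurable_fun [set: R] F -> (forall y, 0 <= F y) ->
  \int[mu]_(y in `]0%R, +oo[) F y = \int[mu]_(x in `]0%R, +oo[) (F (c * x)%R * c%:E).
Proof.
move=> c0 mF F0; rewrite integral_mkcond (ge0_integral_lebesgue_scale c0)//.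
- rewrite [RHS]integral_mkcond; apply: eq_integral => x _.
  rewrite !patchE !mem_setE !in_itv/= !andbT pmulr_rgt0//.
  by case: ifP => //; rewrite mul0e.
- apply: (measurable_restrictT F (measurable_itv `]0%R, +oo[)).1; exact: measurable_funTS.
- by move=> y; exact: erestrict_ge0.
Qed.

Lemma measurable_rV_integral n (D : set R) (K : 'rV[R]_n * R -> \bar R) :
  measurable D -> measurable_fun [set: _] K -> (forall p, 0 <= K p) ->
  measurable_fun [set: 'rV[R]_n] (fun v => \int[mu]_(s in D) K (v, s)).
Proof.
move=> mD mK K0.
rewrite (_ : (fun _ => _) = fun v => \int[mu]_s (K (v, s) * (\1_D s)%:E)); last first.
  apply/funext => v; rewrite integral_mkcond.
  by apply: eq_integral => s _; rewrite epatch_indic.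
apply: (@measurable_fun_fubini_tonelli_F _ _ _ _ R mu
  (fun p : 'rV[R]_n * R => K p * (\1_D p.2)%:E)).
- apply: emeasurable_funM => //; apply/measurable_EFinP.
  exact: (@measurableT_comp _ _ _ _ _ _ (\1_D : R -> R) _ (@snd 'rV[R]_n R)).
- by move=> p; rewrite mule_ge0// lee_fin.
Qed.

(** The map $q$ of the overview: inverse stereographic projection on real points, with no point at
    infinity in its source or target. *)
Definition inv_stereo n (x : 'rV[R]_n) : 'rV[R]_n.+1 :=
  ((1 + enorm x ^+ 2)^-1 *: row_snoc (2 *: x) (enorm x ^+ 2 - 1))%R.

(** The conformal factor of $q$, raised to the dimension of the chart. *)
Definition stereo_jacobian n (x : 'rV[R]_n) : R := ((2 / (1 + enorm x ^+ 2)) ^+ n)%R.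

Lemma measurable_fun_row_snoc d (T : measurableType d) n (v : T -> 'rV[R]_n) (t : T -> R) :
  measurable_fun [set: T] v -> measurable_fun [set: T] t ->
  measurable_fun [set: T] (fun x => row_snoc (v x) (t x)).
Proof.
move=> mv mt; apply: measurable_fun_rV => i; rewrite /comp /rV_coord.
under eq_fun do rewrite mxE.
case: (unlift _ _) => [j|//].
exact: (measurableT_comp (measurable_rV_coord j)).
Qed.

Lemma measurable_fun_rV_scale d (T : measurableType d) n (v : T -> 'rV[R]_n) (t : T -> R) :
  measurable_fun [set: T] t -> measurable_fun [set: T] v ->
  measurable_fun [set: T] (fun x => t x *: v x)%R.
Proof.
move=> mt mv; apply: measurable_fun_rV => i; rewrite /comp /rV_coord.
under eq_fun do rewrite mxE.
apply: measurable_funM => //.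
exact: (measurableT_comp (measurable_rV_coord i)).
Qed.

Lemma measurable_fun_div d (T : measurableType d) (f g : T -> R) :
  measurable_fun [set: T] f -> measurable_fun [set: T] g ->
  measurable_fun [set: T] (fun x => f x / g x)%R.
Proof.
move=> mf mg; apply: measurable_funM => //.
exact: (measurableT_comp (@measurable_inv R)).
Qed.

Lemma measurable_sqr_enorm d (T : measurableType d) n (v : T -> 'rV[R]_n) :
  measurable_fun [set: T] v ->
  measurable_fun [set: T] (fun x => enorm (v x) ^+ 2)%R.
Proof.
by move=> mv; apply: measurable_funX; exact: (measurableT_comp (@measurable_enorm R n)).
Qed.

Lemma measurable_inv_stereo n : measurable_fun [set: _] (@inv_stereo n).
Proof.
have mX : measurable_fun [set: 'rV[R]_n] (fun x => enorm x ^+ 2)%R.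
  exact: (measurable_sqr_enorm (@measurable_id _ 'rV[R]_n setT)).
apply: measurable_fun_rV_scale.
  by apply: (measurableT_comp (@measurable_inv R)); exact: measurable_funD.
apply: measurable_fun_row_snoc; last exact: measurable_funB.
exact: measurable_fun_rV_scale.
Qed.

(** The disintegration of the overview: split off the last coordinate, substitute $s$ for it,
    exchange the integrals, scale $v = s x$ at fixed $s$, exchange back, and scale $s$ at fixed
    $x$. *)
Lemma ge0_integral_rV_polar n (H : 'rV[R]_n.+2 -> \bar R) :
  measurable_fun [set: _] H -> (forall y, 0 <= H y) ->
  \int[lebesgue_rV R n.+2]_y H y =
  \int[lebesgue_rV R n.+1]_x
    (\int[mu]_(r in `]0%R, +oo[) (H (r *: inv_stereo x)%R * (r ^+ n.+1)%:E) *
     (stereo_jacobian x)%:E).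
Proof.
move=> mH H0.
(* [K] is the integrand in $(v, s)$ after the hyperbolic substitution; [L] is the integrand in $(x,
   s)$ after $v = s x$, with the factor $s^{n+1}$ from this scaling. *)
pose K (p : 'rV[R]_n.+1 * R) :=
  H (row_snoc p.1 ((enorm p.1 ^+ 2 / p.2 - p.2) / 2)%R) *
  ((enorm p.1 ^+ 2 / p.2 ^+ 2 + 1) / 2)%:E.
(* The absolute value makes [L] nonnegative for all values of [p.2]. *)
pose L (p : 'rV[R]_n.+1 * R) :=
  H (row_snoc (p.2 *: p.1)%R (p.2 * ((enorm p.1 ^+ 2 - 1) / 2))%R) *
  ((enorm p.1 ^+ 2 + 1) / 2 * `|p.2| ^+ n.+1)%:E.
have m1 : measurable_fun [set: 'rV[R]_n.+1 * R] fst := measurable_fst.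
have m2 : measurable_fun [set: 'rV[R]_n.+1 * R] snd := measurable_snd.
have mX : measurable_fun [set: 'rV[R]_n.+1 * R] (fun p => enorm p.1 ^+ 2)%R.
  exact: measurable_sqr_enorm.
have mK : measurable_fun [set: _] K.
  apply: emeasurable_funM.
    apply: (measurableT_comp mH); apply: measurable_fun_row_snoc => //.
    apply: measurable_fun_div => //; apply: measurable_funB => //.
    exact: measurable_fun_div.
  apply/measurable_EFinP; apply: measurable_fun_div => //.
  apply: measurable_funD => //; apply: measurable_fun_div => //.
  exact: measurable_funX.
have mL : measurable_fun [set: _] L.
  apply: emeasurable_funM.
    apply: (measurableT_comp mH); apply: measurable_fun_row_snoc => //.
      exact: measurable_fun_rV_scale.
    apply: measurable_funM => //; apply: measurable_funM => //.
    exact: measurable_funB.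
  apply/measurable_EFinP; apply: measurable_funM => //; last exact/measurable_funX/measurableT_comp.
  apply: measurable_fun_div => //; exact: measurable_funD.
have K0 p : 0 <= K p.
  by rewrite mule_ge0// lee_fin divr_ge0// addr_ge0// divr_ge0 ?sqr_ge0.
have L0 p : 0 <= L p.
  by rewrite mule_ge0// lee_fin mulr_ge0// ?exprn_ge0// divr_ge0// addr_ge0// sqr_ge0.
have mD : measurable (`]0%R, +oo[%classic : set R) by [].
transitivity (\int[lebesgue_rV R n.+1]_v \int[mu]_(s in `]0%R, +oo[) K (v, s)).
  rewrite ge0_integral_rVS//.
  (* The origin is removed on both sides, because the hyperbolic substitution requires $|v|^2 >
     0$. *)
  have m0 := @measurable_rV_set0 R n.+1.
  have z0 := @lebesgue_rV_set0 R n.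
  rewrite (ge0_negligible_integral m0)//; last 2 first.
  - apply: (@measurable_rV_integral _ setT (fun p => H (row_snoc p.1 p.2))) => //.
    by apply: (measurableT_comp mH); exact: measurable_fun_row_snoc.
  - by move=> v _; exact: integral_ge0.
  rewrite [RHS](ge0_negligible_integral m0)//; last 2 first.
  - exact: measurable_rV_integral.
  - by move=> v _; exact: integral_ge0.
  apply: eq_integral => v; rewrite inE => -[_ /eqP v0].
  apply: (@ge0_integral_lebesgue_hyperbolic R (enorm v ^+ 2)%R
    (fun t => H (row_snoc v t))) => //.
  - by rewrite exprn_gt0// lt_def enorm_eq0 v0 enorm_ge0.
  - by apply: (measurableT_comp mH); exact: measurable_fun_row_snoc.
rewrite ge0_integral_rV_exchange//.
transitivity (\int[mu]_(s in `]0%R, +oo[) \int[lebesgue_rV R n.+1]_x L (x, s)).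
  apply: eq_integral => s; rewrite inE/= in_itv/= andbT => s0.
  rewrite (ge0_integral_rV_scale s0)//; last first.
    exact: (measurableT_comp mK).
  apply: eq_integral => x _; rewrite /K/L/= enormZ gtr0_norm// exprMn.
  rewrite -muleA -EFinM; congr (H (row_snoc _ _) * (_ * _)%:E)%E.
  - by field; rewrite gt_eqF.
  - by field; rewrite gt_eqF.
rewrite -ge0_integral_rV_exchange//.
apply: eq_integral => x _.
have X0 : (0 < 1 + enorm x ^+ 2)%R by rewrite ltr_pwDl// sqr_ge0.
(* With this constant $k$, $s = k r$ turns $s (x, (|x|^2 - 1)/2)$ into $r q(x)$. *)
have k0 : (0 < 2 / (1 + enorm x ^+ 2))%R by rewrite divr_gt0.
have mHx : measurable_fun [set: R] (fun r => H (r *: inv_stereo x)%R).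
  by apply: (measurableT_comp mH); exact: measurable_fun_rV_scale.
rewrite (ge0_integral_pos_scale k0)//; last exact: (measurableT_comp mL).
rewrite -ge0_integralZr//; last 3 first.
- apply: measurable_funTS; apply: emeasurable_funM => //; apply/measurable_EFinP.
  exact: measurable_funX.
- by move=> r /=; rewrite in_itv/= andbT => r0; rewrite mule_ge0// lee_fin exprn_ge0// ltW.
- by rewrite lee_fin exprn_ge0// ltW.
apply: eq_integral => r; rewrite inE/= in_itv/= andbT => r0.
rewrite /L/= normrM !gtr0_norm// -!muleA -!EFinM; congr (H _ * _%:E)%E.
  rewrite /inv_stereo scalerA !scale_row_snoc scalerA; congr row_snoc.
    by congr (_ *: _)%R; field; rewrite gt_eqF.
  by field; rewrite gt_eqF.
(* The weight $k^{-1} (k r)^{n+1}$ times the factor $k$ of the substitution is $r^{n+1} k^{n+1}$,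
   and $k^{n+1}$ is the Jacobian. *)
rewrite /stereo_jacobian exprMn (addrC (enorm x ^+ 2)%R) !mulrA.
rewrite -[((1 + _) / 2)%R]invf_div.
set k := (2 / _)%R; rewrite -(mulrA _ 2%R) -/k; by field; rewrite gt_eqF.
Qed.

End polar_coordinates.

(** * Surface area in the stereographic chart, and the total area of the sphere *)

Section surface_area_theory.
Context (R : realType).
Notation mu := (@lebesgue_measure R).
Local Open Scope ereal_scope.

Lemma integral_exprn01 n :
  \int[mu]_(r in `]0%R, 1%R]) (r ^+ n)%:E = (n.+1%:R^-1)%:E :> \bar R.
Proof.
rewrite integral_itv_obnd_cbnd; last first.
  by apply/measurable_EFinP/measurable_funTS; exact: measurable_funX.
pose F (x : R) := (n.+1%:R^-1 * x ^+ n.+1)%R.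
have dF (x : R) : is_derive x 1%R F (x ^+ n)%R.
  have := is_deriveZ n.+1%:R^-1%R (is_deriveX n.+1 (is_derive_id x 1%R)).
  congr is_derive; last by rewrite /GRing.scale/= mulr1 mulrA mulVf ?mul1r// pnatr_eq0.
  by apply/funext => y; rewrite !fctE.
have cF (x : R) : {for x, continuous F}.
  by apply/differentiable_continuous/derivable1_diffP; case: (dF x).
rewrite (@continuous_FTC2 R (fun r => r ^+ n)%R F)//.
- by rewrite /F expr1n expr0n/= mulr0 mulr1 sube0.
- by apply: continuous_subspaceT => x; exact: exprn_continuous.
- split => [x _| |].
  + by case: (dF x).
  + exact/cvg_at_right_filter/cF.
  + exact/cvg_at_left_filter/cF.
- by move=> x _; rewrite derive1E; case: (dF x).
Qed.

Lemma enorm_inv_stereo n (x : 'rV[R]_n) : enorm (inv_stereo x) = 1%R.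
Proof.
have X0 : (0 < 1 + enorm x ^+ 2)%R by rewrite ltr_pwDl// sqr_ge0.
apply/eqP; rewrite -(@eqrXn2 _ 2)// ?enorm_ge0// expr1n.
rewrite /inv_stereo scale_row_snoc sqr_enorm_row_snoc !enormZ !normr_nat.
rewrite gtr0_norm ?invr_gt0//; apply/eqP.
by field; rewrite gt_eqF.
Qed.

Lemma stereo_jacobian_ge0 n (x : 'rV[R]_n) : (0 <= stereo_jacobian x)%R.
Proof. by rewrite exprn_ge0// divr_ge0// addr_ge0// sqr_ge0. Qed.

Lemma measurable_stereo_jacobian n : measurable_fun [set: _] (@stereo_jacobian R n).
Proof.
apply: measurable_funX; apply: measurable_fun_div => //; apply: measurable_funD => //.
exact: (measurable_sqr_enorm (@measurable_id _ 'rV[R]_n setT)).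
Qed.

(** Apply the polar formula to the indicator of the cone over [A]: $r q(x)$ lies in it iff $r \le 1$
    and $q(x) \in A$. The radial integral $1/(n+2)$ cancels the factor in [surface_area]. The
    intersection with [[set: _]] gives the shape of [density_image]. *)
Lemma surface_areaE n (A : set 'rV[R]_n.+2) : measurable A ->
  surface_area R n.+2 A =
  \int[lebesgue_rV R n.+1]_(x in [set: _] `&` @inv_stereo R n.+1 @^-1` A)
    (stereo_jacobian x)%:E.
Proof.
move=> mA; rewrite setTI.
pose B := (@direction R n.+2 @^-1` A) `&` @punctured_ball R n.+2.
have mB : measurable B.
  apply: measurableI; last exact: measurable_punctured_ball.
  by rewrite -[X in measurable X]setTI; exact: measurable_direction.
have -> : surface_area R n.+2 A = n.+2%:R%:E * lebesgue_rV R n.+2 B by [].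
rewrite -[X in lebesgue_rV R _ X]setIT -(@integral_indic _ _ R (lebesgue_rV R n.+2))//.
rewrite ge0_integral_rV_polar//; last exact/measurable_EFinP/measurable_indic.
have BE x (r : R) : (0 < r)%R ->
    (r *: inv_stereo x \in B) = (r <= 1)%R && (inv_stereo x \in A).
  move=> r0; have rE : enorm (r *: inv_stereo x) = r.
    by rewrite enormZ enorm_inv_stereo mulr1 gtr0_norm.
  have dE : direction (r *: inv_stereo x) = inv_stereo x.
    by rewrite /direction rE scalerA mulVf ?scale1r// gt_eqF.
  apply/idP/andP; rewrite !inE /B /punctured_ball /= dE rE r0/=.
    by case.
  by move=> [].
have inner (x : 'rV[R]_n.+1) :
    \int[mu]_(r in `]0%R, +oo[) ((\1_B (r *: inv_stereo x)%R)%:E * (r ^+ n.+1)%:E) =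
    (\1_(@inv_stereo R n.+1 @^-1` A) x / n.+2%:R)%:E.
  rewrite indicE -[x \in _]/(inv_stereo x \in A); case: (boolP (inv_stereo x \in A)) => [xA|xA].
    rewrite /= mulr1n mul1r -integral_exprn01 [LHS]integral_mkcond [RHS]integral_mkcond.
    apply: eq_integral => r _; rewrite !patchE !mem_setE !in_itv/= andbT.
    case: ifPn => //= r0; rewrite indicE BE// xA andbT.
    by case: ifP; rewrite ?mul1e ?mul0e.
  rewrite /= mulr0n mul0r; apply: integral0_eq => r /=; rewrite in_itv/= andbT => r0.
  by rewrite indicE BE// (negbTE xA) andbF mul0e.
under eq_integral do rewrite inner -EFinM -mulrA mulrCA EFinM.
have mJ : measurable_fun setT (@stereo_jacobian R n.+1) by exact: measurable_stereo_jacobian.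
have J0 x : (0 <= @stereo_jacobian R n.+1 x)%R by exact: stereo_jacobian_ge0.
rewrite ge0_integralZl//; last 2 first.
- apply/measurable_EFinP/measurable_funM => //; apply: measurable_indic.
  by rewrite -[X in measurable X]setTI; exact: measurable_inv_stereo.
- by move=> x _; rewrite lee_fin mulr_ge0.
rewrite muleA -EFinM divff ?pnatr_eq0// mul1e [RHS]integral_mkcond.
by apply: eq_integral => x _; rewrite epatch_indic muleC.
Qed.

Lemma ge0_integral_surface_area n (F : 'rV[R]_n.+2 -> \bar R) :
  measurable_fun [set: _] F -> (forall y, 0 <= F y) ->
  \int[surface_area R n.+2]_y F y =
  \int[lebesgue_rV R n.+1]_x (F (inv_stereo x) * (stereo_jacobian x)%:E).
Proof.
move=> mF F0.
apply: (@ge0_integral_cov _ _ _ _ R (lebesgue_rV R n.+1) _ _ setT) => //.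
- exact: measurable_inv_stereo.
- exact: measurable_stereo_jacobian.
- by move=> x _; exact: stereo_jacobian_ge0.
- exact: surface_areaE.
Qed.

(** The Gaussian factors over the coordinates, and each contributes the one-dimensional integral
    $\sqrt\pi$. *)
Lemma gauss_rV n :
  \int[lebesgue_rV R n]_x (expR (- enorm x ^+ 2))%:E = (Num.sqrt pi ^+ n)%:E.
Proof.
have mg m : measurable_fun [set: 'rV[R]_m] (fun x => expR (- enorm x ^+ 2)%R).
  apply: measurableT_comp => //; apply: measurableT_comp => //.
  exact: (measurable_sqr_enorm (@measurable_id _ 'rV[R]_m setT)).
elim: n => [|n ih].
  rewrite /= integral_dirac//; last by apply/measurable_EFinP; exact: (mg 0%N).
  have -> : enorm (0 : 'rV[R]_0) = 0%R by apply/eqP; rewrite enorm_eq0.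
  by rewrite expr0n oppr0 expR0 diracT mul1e.
rewrite ge0_integral_rVS//; last by apply/measurable_EFinP; exact: mg.
rewrite exprSr EFinM -ih -ge0_integralZr//; last first.
  by apply/measurable_EFinP; exact: mg.
apply: eq_integral => v _; rewrite -integralT_gauss -ge0_integralZl//.
- by apply: eq_integral => t _; rewrite sqr_enorm_row_snoc opprD expRD.
- by apply/measurable_EFinP; exact: measurable_gauss_fun.
- by move=> t _; rewrite lee_fin gauss_fun_ge0.
Qed.

Lemma integral_Gamma_half n :
  \int[mu]_(t in `]0%R, +oo[) (t `^ (n.+2%:R / 2 - 1) * expR (- t))%:E =
  2%:E * \int[mu]_(r in `]0%R, +oo[) ((expR (- r ^+ 2))%:E * (r ^+ n.+1)%:E) :> \bar R.
Proof.
(* The substitutions t = exp (- h) and r ^+ 2 = exp (- h) turn both sides into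
   the integral of [Phi] over the line. *)
pose Phi (h : R) : \bar R := (expR (- h * (n.+2%:R / 2)) * expR (- expR (- h)))%:E.
have mPhi : measurable_fun [set: R] Phi.
  apply/measurable_EFinP/measurable_funM.
    apply: measurableT_comp => //; apply: measurable_funM => //.
  apply: (measurableT_comp (@measurable_expR R)); apply: measurable_funN.
  by apply: (measurableT_comp (@measurable_expR R)); exact: oppr_measurable.
have Phi0 h : 0 <= Phi h by rewrite lee_fin mulr_ge0// expR_ge0.
have lnE c (c0 : (0 < c)%R) := esym (@ge0_integral_lebesgue_ln R c Phi c0 mPhi Phi0).
rewrite -ge0_integralZl//; last 2 first.
- apply: emeasurable_funM; apply/measurable_EFinP/measurable_funTS.
    exact: measurable_gauss_fun.
  exact: measurable_funX.
- move=> r /=; rewrite in_itv/= andbT => r0.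
  by rewrite mule_ge0// lee_fin ?expR_ge0// exprn_ge0// ltW.
transitivity (\int[mu]_h Phi h); [rewrite -(lnE 1%R)//|rewrite -(lnE 2%R)//].
  apply: eq_integral => t; rewrite inE/= in_itv/= andbT => t0.
  rewrite -EFinM; congr (_%:E); rewrite opprK mul1r lnK ?posrE//.
  rewrite /powR gt_eqF// mulrBl mul1r expRB lnK ?posrE//.
  by rewrite (mulrC (ln t)); field; rewrite gt_eqF.
apply: eq_integral => t; rewrite inE/= in_itv/= andbT => t0.
rewrite -!EFinM; congr (_%:E); rewrite opprK.
have e2 : expR (2 * ln t) = (t ^+ 2)%R.
  by rewrite expRM_natl lnK// posrE.
have en : expR (2 * ln t * (n.+2%:R / 2)) = (t ^+ n.+2)%R.
  have -> : (2 * ln t * (n.+2%:R / 2) = n.+2%:R * ln t)%R by field.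
  by rewrite expRM_natl lnK// posrE.
by rewrite e2 en (exprSr _ n.+1); field; rewrite gt_eqF.
Qed.

Lemma measurable_sphere n : measurable (@sphere R n).
Proof.
rewrite -[sphere (R:=R) (n:=n)]setTI.
exact: (@measurable_enorm R n measurableT _ (measurable_set1 1%R)).
Qed.

(** In polar coordinates the Gaussian integral $\pi^{(n+2)/2}$ is the radial integral [C] times the
    area [a], and Gamma at $(n+2)/2$ is $2C$. *)
Lemma Gamma_surface_area n :
  (0 < Gamma (n.+2%:R / 2 : R))%R /\
  surface_area R n.+2 (@sphere R n.+2) =
    (2 * pi `^ (n.+2%:R / 2) / Gamma (n.+2%:R / 2))%:E.
Proof.
pose C := \int[mu]_(r in `]0%R, +oo[) ((expR (- r ^+ 2))%:E * (r ^+ n.+1)%:E).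
pose a := \int[lebesgue_rV R n.+1]_x (@stereo_jacobian R n.+1 x)%:E.
have C0 : 0 <= C.
  apply: integral_ge0 => r /=; rewrite in_itv/= andbT => r0.
  by rewrite mule_ge0// lee_fin ?expR_ge0// exprn_ge0// ltW.
have a0 : 0 <= a by apply: integral_ge0 => x _; rewrite lee_fin stereo_jacobian_ge0.
have Ca : (pi `^ (n.+2%:R / 2))%:E = C * a.
  have -> : (pi `^ (n.+2%:R / 2) = Num.sqrt pi ^+ n.+2 :> R)%R.
    by rewrite -powR12_sqrt ?pi_ge0// -powR_mulrn ?powR_ge0// -powRrM mulrC.
  rewrite -gauss_rV ge0_integral_rV_polar//; last first.
    apply/measurable_EFinP/measurableT_comp => //; apply: measurable_funN.
    exact: (measurable_sqr_enorm (@measurable_id _ 'rV[R]_n.+2 setT)).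
  have mJ : measurable_fun [set: 'rV[R]_n.+1] (fun x => (stereo_jacobian x)%:E).
    by apply/measurable_EFinP; exact: measurable_stereo_jacobian.
  have J0 (x : 'rV[R]_n.+1) : [set: _] x -> 0 <= (stereo_jacobian x)%:E.
    by move=> _; rewrite lee_fin stereo_jacobian_ge0.
  have -> : C * a = _ := esym (ge0_integralZl (lebesgue_rV R n.+1) measurableT mJ J0 C0).
  apply: eq_integral => x _; congr (_ * _).
  apply: eq_integral => r; rewrite inE/= in_itv/= andbT => r0.
  by rewrite enormZ enorm_inv_stereo mulr1 gtr0_norm.
have p0 : (0 < pi `^ (n.+2%:R / 2) :> R)%R by rewrite powR_gt0 ?pi_gt0.
have -> : surface_area R n.+2 (@sphere R n.+2) = a.
  rewrite surface_areaE; last exact: measurable_sphere.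
  rewrite setTI (_ : _ @^-1` _ = setT)//; apply/seteqP; split => // x _.
  exact: enorm_inv_stereo.
(* [Gamma] is a real-valued integral, hence the [fine]; finiteness of [C] is still to be shown. *)
have -> : Gamma (n.+2%:R / 2 : R) = fine (2%:E * C).
  by rewrite /Gamma /Rintegral integral_Gamma_half.
(* As [C * a] is a positive real, neither factor can be zero or infinite. *)
move: Ca C0 a0; case: C => [c| |]//; case: a => [b| |]//; rewrite ?lee_fin.
- rewrite -EFinM => -[Ca] c0 b0.
  have c_gt0 : (0 < c)%R.
    by rewrite lt_def c0 andbT; apply: contraTneq p0 => c0'; rewrite Ca c0' mul0r ltxx.
  split => /=; first by rewrite mulr_gt0.
  by rewrite Ca; congr EFin; field; rewrite gt_eqF.
- move=> + c0 _; move: c0; rewrite le_eqVlt => /predU1P[<-|c0].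
    by rewrite mul0e => -[pE]; move: p0; rewrite pE ltxx.
  by rewrite gt0_muley// lte_fin.
- move=> + _ b0; move: b0; rewrite le_eqVlt => /predU1P[<-|b0].
    by rewrite mule0 => -[pE]; move: p0; rewrite pE ltxx.
  by rewrite gt0_mulye// lte_fin.
Qed.

End surface_area_theory.

(** * Stereographic projection *)

Section stereographic_geometry.
Context (R : realType) (n : nat).
Implicit Types (x u : 'rV[R]_n) (v : 'rV[R]_n.+1) (t : R).

Lemma north_row_snoc : north R n = row_snoc 0 1.
Proof.
apply/rowP => i; rewrite !mxE eqxx/=; case: unliftP => [j ->|->].
  by rewrite mxE eq_sym (negbTE (neq_lift _ _)).
by rewrite eqxx.
Qed.

Lemma sqr_enorm_sub_north u t :
  enorm (row_snoc u t - north R n) ^+ 2 = enorm u ^+ 2 + (t - 1) ^+ 2.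
Proof. by rewrite north_row_snoc sub_row_snoc subr0 sqr_enorm_row_snoc. Qed.

Lemma sqr_enorm_sub m (x u : 'rV[R]_m) (a b : R) :
  enorm (a *: x - b *: u) ^+ 2 =
  a ^+ 2 * enorm x ^+ 2 - 2 * a * b * (\sum_i x 0 i * u 0 i) + b ^+ 2 * enorm u ^+ 2.
Proof.
rewrite !sqr_enorm !mulr_sumr -sumrB -big_split/=.
by apply: eq_bigr => i _; rewrite !mxE; ring.
Qed.

Lemma row_snocP v : {p : 'rV[R]_n * R | v = row_snoc p.1 p.2}.
Proof. by exists (col' ord_max v, v 0 ord_max); rewrite row_snoc_col'. Qed.

Lemma enorm_gt0 m (x : 'rV[R]_m) : x != 0 -> 0 < enorm x ^+ 2.
Proof. by move=> x0; rewrite exprn_gt0// lt_def enorm_eq0 x0 enorm_ge0. Qed.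

Lemma stereo_row_snoc u t : row_snoc u t != north R n ->
  let D := enorm u ^+ 2 + (t - 1) ^+ 2 in
  0 < D /\
  stereo (Some (row_snoc u t)) =
    Some ((2 / D) *: u, (1 - (enorm u ^+ 2 + t ^+ 2)) / D).
Proof.
move=> vN D; split.
  by rewrite /D -sqr_enorm_sub_north enorm_gt0// subr_eq0.
by rewrite /stereo (negbTE vN) col'_row_snoc sqr_enorm_sub_north sqr_enorm_row_snoc.
Qed.

Lemma stereoK : cancel (@stereo R n) (@stereo_inv R n).
Proof.
move=> [v|] /=; last by rewrite !eqxx.
have [[u t] /= ->] := row_snocP v; case: ifPn => [/eqP ->//|vN].
have [] := stereo_row_snoc vN; rewrite /stereo (negbTE vN) => + [-> ->].
(* Replacing $|u|^2$ by $D - (t-1)^2$ leaves rational identities in $D$ and $t$ with $D \ne 0$. *)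
have UE : enorm u ^+ 2 = enorm u ^+ 2 + (t - 1) ^+ 2 - (t - 1) ^+ 2 by rewrite addrK.
move: (enorm u ^+ 2 + (t - 1) ^+ 2) UE => D UE D0; rewrite UE /=.
have D_neq0 : D != 0 by rewrite gt_eqF.
set s := (1 - _) / D.
have s1 : 1 + s = 2 * (1 - t) / D by rewrite /s; field.
(* The value $-i$ would force $u = 0$ and $t = 1$, that is, the excluded north pole. *)
case: ifPn => [/andP[]|_].
  rewrite scaler_eq0 mulf_eq0 invr_eq0 pnatr_eq0/= (negbTE D_neq0)/= => /eqP u0 /eqP s1'.
  move/eqP: s1; rewrite s1' subrr eq_sym !mulf_eq0 invr_eq0 (negbTE D_neq0) pnatr_eq0/= orbF.
  rewrite subr_eq0 => /eqP t1.
  by move: vN; rewrite u0 -t1 north_row_snoc eqxx.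
have muE : enorm ((2 / D) *: u) ^+ 2 = 4 * (D - (t - 1) ^+ 2) / D ^+ 2.
  by rewrite enormZ exprMn real_normK ?num_real// UE; field.
have EE : enorm ((2 / D) *: u) ^+ 2 + (1 + s) ^+ 2 = 4 / D.
  by rewrite muE s1; field.
rewrite EE scale_row_snoc scalerA muE; congr (Some (row_snoc _ _)).
  by rewrite -[RHS]scale1r; congr (_ *: _); field.
by rewrite /s; field.
Qed.

Lemma stereo_invK : cancel (@stereo_inv R n) (@stereo R n).
Proof.
move=> [[mu s]|] /=; last by rewrite eqxx.
case: ifPn => [/andP[/eqP -> /eqP ->]//|mus].
have E0 : 0 < enorm mu ^+ 2 + (1 + s) ^+ 2.
  rewrite lt_def paddr_eq0 ?sqr_ge0// addr_ge0 ?sqr_ge0// andbT.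
  by rewrite !sqrf_eq0 enorm_eq0 addrC addr_eq0.
(* As for [stereoK], $|\mu|^2$ is eliminated in favour of the denominator $E$. *)
have ME : enorm mu ^+ 2 = enorm mu ^+ 2 + (1 + s) ^+ 2 - (1 + s) ^+ 2 by rewrite addrK.
move: (enorm mu ^+ 2 + (1 + s) ^+ 2) ME E0 => E ME E0; rewrite ME scale_row_snoc.
have E_neq0 : E != 0 by rewrite gt_eqF.
set u := _ *: mu; set t := 2 / E * _.
have uE : enorm u ^+ 2 = 4 * (E - (1 + s) ^+ 2) / E ^+ 2.
  by rewrite enormZ exprMn real_normK ?num_real// ME; field.
(* At the north pole $u = 0$ and $t = 1$, which give $\mu = 0$ and $\sigma = -1$, the excluded point
   $-i$. *)
have vN : row_snoc u t != north R n.
  apply: contraNneq mus => vN; have t1 : t = 1.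
    by rewrite -(row_snoc_max u t) vN north_row_snoc row_snoc_max.
  have u0 : u = 0.
    by rewrite -(col'_row_snoc u t) vN north_row_snoc col'_row_snoc.
  move/eqP: u0; rewrite scaler_eq0 mulf_eq0 invr_eq0 pnatr_eq0/= (negbTE E_neq0)/= => ->/=.
  have : t - 1 = - (2 * (1 + s) / E) by rewrite /t; field.
  rewrite t1 subrr => /esym/eqP; rewrite oppr_eq0 !mulf_eq0 pnatr_eq0/= invr_eq0 (negbTE E_neq0) orbF.
  by rewrite addrC addr_eq0.
have [_] := stereo_row_snoc vN; rewrite /stereo => ->.
have -> : enorm u ^+ 2 + (t - 1) ^+ 2 = 4 / E.
  by rewrite uE /t; field.
congr (Some (_, _)).
  by rewrite scalerA -[RHS]scale1r; congr (_ *: _); field.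
by rewrite uE /t; field.
Qed.

Lemma stereo_inv_real x : stereo_inv (Some (x, 0)) = Some (inv_stereo x).
Proof.
have X0 : 1 + enorm x ^+ 2 != 0 by rewrite gt_eqF// ltr_pwDl// sqr_ge0.
rewrite /stereo_inv [0 == -1]eq_sym oppr_eq0 oner_eq0 andbF; congr Some.
rewrite /inv_stereo !scale_row_snoc addr0 expr1n scalerA; congr row_snoc.
  by rewrite [_ + 1]addrC; congr (_ *: _); field.
  by rewrite [_ + 1]addrC; field.
Qed.

Lemma stereo_inv_stereo x : stereo (Some (inv_stereo x)) = Some (x, 0).
Proof. by rewrite -stereo_inv_real stereo_invK. Qed.

Lemma enorm_north : enorm (north R n) = 1.
Proof.
apply/eqP; rewrite -(@eqrXn2 _ 2)// ?enorm_ge0// north_row_snoc sqr_enorm_row_snoc.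
have -> : enorm (0 : 'rV[R]_n) = 0 by apply/eqP; rewrite enorm_eq0.
by rewrite expr0n add0r !expr1n.
Qed.

(** Put $\sigma = (1 - |\phi|^2)/D$ and $\mu = 2\phi'/D$ in the last identity of the overview: it
    becomes $(1 + |x|^2) |q(x) - \phi|^2 = D (\sigma^2 + |x - \mu|^2)$. *)
Lemma stereo_cauchy_kernel v (mu x : 'rV[R]_n) (s : R) :
  enorm v != 1 -> stereo (Some v) = Some (mu, s) ->
  `|1 - enorm v ^+ 2| / enorm (inv_stereo x - v) ^+ 2 * (2 / (1 + enorm x ^+ 2)) =
  2 * (`|s| / (s ^+ 2 + enorm (x - mu) ^+ 2)).
Proof.
move=> v1; have vN : v != north R n.
  by apply: contraNneq v1 => ->; rewrite enorm_north.
have w1 : 1 - enorm v ^+ 2 != 0.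
  by rewrite subr_eq0 eq_sym -[1](expr1n _ 2) eqrXn2 ?enorm_ge0.
move: (col' ord_max v) (v 0 ord_max) (esym (row_snoc_col' v)) => u t vE.
rewrite vE in vN w1 *.
have [D0 ->] := stereo_row_snoc vN => -[<- <-].
rewrite sqr_enorm_row_snoc in w1 *.
rewrite {1}/inv_stereo scale_row_snoc scalerA sub_row_snoc sqr_enorm_row_snoc.
(* Both squared distances depend on [x] and [u] only through this inner product and the two
   norms. *)
pose P := \sum_i x 0 i * u 0 i.
have subl a : enorm (a *: x - u) ^+ 2 = a ^+ 2 * enorm x ^+ 2 - 2 * a * P + enorm u ^+ 2.
  by rewrite -[in LHS](scale1r u) sqr_enorm_sub -/P; ring.
have subr b : enorm (x - b *: u) ^+ 2 = enorm x ^+ 2 - 2 * b * P + b ^+ 2 * enorm u ^+ 2.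
  by rewrite -[in LHS](scale1r x) sqr_enorm_sub -/P; ring.
have X0 : 1 + enorm x ^+ 2 != 0 by rewrite gt_eqF// ltr_pwDl// sqr_ge0.
(* Recorded before the norms are abstracted, so that the denominator [Z] can still be proved
   positive. *)
have Y0 := sqr_ge0 (enorm (x - (2 / (enorm u ^+ 2 + (t - 1) ^+ 2)) *: u)).
rewrite subl subr in Y0 *.
rewrite normrM normfV (gtr0_norm D0).
have UE : enorm u ^+ 2 = enorm u ^+ 2 + (t - 1) ^+ 2 - (t - 1) ^+ 2 by rewrite addrK.
move: P (enorm x ^+ 2) X0 Y0 {subl subr} => P X X0 Y0.
move: (enorm u ^+ 2 + (t - 1) ^+ 2) UE D0 Y0 => D UE D0 Y0.
rewrite UE in w1 Y0 *.
have D_neq0 : D != 0 by rewrite gt_eqF.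
set Q := (X in _ / X * _); set Z := (X in _ = 2 * (_ / X)).
have Z_neq0 : Z != 0.
  by rewrite /Z gt_eqF// ltr_wpDr// exprn_even_gt0//= mulf_neq0// invr_eq0.
have QE : Q = D * Z / (1 + X).
  by rewrite /Q /Z; field; rewrite X0 D_neq0.
rewrite QE; move: `|_| Z Z_neq0 {QE Q} => N Z Z_neq0.
by field; rewrite X0 D_neq0 Z_neq0.
Qed.

End stereographic_geometry.

(** * Measurability of the projection and its inverse on the extended spaces *)

Section extended_measurability.
Context (R : realType).

(** The sigma-algebra on [option T] puts no condition on [None], so only finite points are
    tested. *)
Lemma measurable_fun_option d d' (T : measurableType d) (T' : measurableType d')
    (f : option T -> T') :
  measurable_fun [set: T] (f \o Some) -> measurable_fun [set: option T] f.
Proof. by move=> mf _ A mA; rewrite setTI; have := mf measurableT A mA; rewrite setTI. Qed.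

Lemma measurable_Some d (T : measurableType d) : measurable_fun [set: T] (@Some T).
Proof. by move=> _ A mA; rewrite setTI. Qed.

Lemma measurable_fun_eq_rV d (T : measurableType d) n (f : T -> 'rV[R]_n) (a : 'rV[R]_n) :
  measurable_fun [set: T] f -> measurable_fun [set: T] (fun x => f x == a).
Proof.
move=> mf; apply: (measurable_fun_bool true).
have -> : [set: T] `&` (fun x => f x == a) @^-1` [set true] =
    [set: T] `&` (fun x => enorm (f x - a)) @^-1` [set 0].
  rewrite !setTI; apply/seteqP; split => x /=.
    by move/eqP->; apply/eqP; rewrite enorm_eq0 subrr.
  by move/eqP; rewrite enorm_eq0 subr_eq0.
apply: (measurableT_comp (@measurable_enorm R n)) => //.
apply: measurable_fun_rV => i; rewrite /comp /rV_coord.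
under eq_fun do rewrite !mxE.
apply: measurable_funB => //; exact: (measurableT_comp (measurable_rV_coord i)).
Qed.

Lemma measurable_sub_rV n (a : 'rV[R]_n) : measurable_fun [set: 'rV[R]_n] (fun x => x - a).
Proof.
apply: measurable_fun_rV => i; rewrite /comp /rV_coord.
under eq_fun do rewrite !mxE.
by apply: measurable_funB => //; exact: measurable_rV_coord.
Qed.

Lemma measurable_stereo n : measurable_fun [set: extR R n.+1] (@stereo R n).
Proof.
apply: measurable_fun_option; rewrite /comp/=.
apply: measurable_fun_ifT; [| exact: measurable_cst |].
  exact: measurable_fun_eq_rV.
apply: (measurableT_comp (@measurable_Some _ _)).
have mD : measurable_fun [set: 'rV[R]_n.+1] (fun x => enorm (x - north R n) ^+ 2).
  exact: (measurable_sqr_enorm (@measurable_sub_rV _ _)).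
apply: measurable_fun_pair.
  apply: measurable_fun_rV_scale; first exact: measurable_fun_div.
  apply: measurable_fun_rV => i; rewrite /comp /rV_coord.
  by under eq_fun do rewrite !mxE; exact: measurable_rV_coord.
apply: measurable_fun_div => //; apply: measurable_funB => //.
exact: (measurable_sqr_enorm (@measurable_id _ 'rV[R]_n.+1 setT)).
Qed.

Lemma measurable_stereo_inv n : measurable_fun [set: extC R n] (@stereo_inv R n).
Proof.
apply: measurable_fun_option; rewrite /comp/=.
have -> : (fun x : 'rV[R]_n * R => stereo_inv (Some x)) =
  (fun x => if (x.1 == 0) && (x.2 == -1) then None else
   Some ((2 / (enorm x.1 ^+ 2 + (1 + x.2) ^+ 2)) *:
         row_snoc x.1 ((enorm x.1 ^+ 2 + x.2 ^+ 2 - 1) / 2))).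
  by apply/funext => -[].
have m1 : measurable_fun [set: 'rV[R]_n * R] fst := measurable_fst.
have m2 : measurable_fun [set: 'rV[R]_n * R] snd := measurable_snd.
have mX : measurable_fun [set: 'rV[R]_n * R] (fun p => enorm p.1 ^+ 2)%R.
  exact: measurable_sqr_enorm.
apply: measurable_fun_ifT; [|exact: measurable_cst|].
  apply: measurable_and; first exact: measurable_fun_eq_rV.
  exact: measurable_fun_eqr.
apply: (measurableT_comp (@measurable_Some _ _)).
apply: measurable_fun_rV_scale.
  apply: measurable_fun_div => //; apply: measurable_funD => //.
  by apply: measurable_funX; exact: measurable_funD.
apply: measurable_fun_row_snoc => //; apply: measurable_fun_div => //.
by apply: measurable_funB => //; apply: measurable_funD => //; exact: measurable_funX.
Qed.

End extended_measurability.

(** * Transport of the spherical Cauchy laws by the projection *)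

Section cauchy_laws.
Context (R : realType) (n : nat).
Implicit Types (v : 'rV[R]_n.+2) (x : 'rV[R]_n.+1).

Lemma sphcauchy_pdf_ge0 v y : 0 <= sphcauchy_pdf v y.
Proof.
have [G0 _] := Gamma_surface_area R n.
rewrite mulr_ge0//; first by rewrite divr_ge0 ?mulr_ge0 ?powR_ge0// ltW.
by rewrite exprn_ge0// divr_ge0// sqr_ge0.
Qed.

Lemma measurable_sphcauchy_pdf v : measurable_fun [set: _] (sphcauchy_pdf v).
Proof.
apply: measurable_funM => //; apply: measurable_funX; apply: measurable_fun_div => //.
exact: (measurable_sqr_enorm (@measurable_sub_rV _ _ v)).
Qed.

(** The kernel identity raised to the power $n+1$ yields $2^{n+1}$; the $1/2$ in the spherical
    constant reduces it to the $2^n$ of the $t$-density. *)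
Lemma sphcauchy_pdf_inv_stereo v mu x (s : R) :
  enorm v != 1 -> stereo (Some v) = Some (mu, s) ->
  sphcauchy_pdf v (inv_stereo x) * stereo_jacobian x = tcauchy_pdf mu s x.
Proof.
move=> v1 vE; rewrite /sphcauchy_pdf /stereo_jacobian -mulrA -exprMn.
rewrite (stereo_cauchy_kernel _ v1 vE) exprMn mulrA /tcauchy_pdf; congr (_ * _).
have p0 : pi `^ (n.+2%:R / 2) != 0 :> R by rewrite gt_eqF// powR_gt0 ?pi_gt0.
by rewrite exprS/=; field.
Qed.

(** The case $\phi = \infty$, sent to $-i$: the Jacobian is already the $t$-kernel at $\mu = 0$,
    $\sigma = -1$, and the total area supplies the constant. *)
Lemma uniform_pdf_inv_stereo x :
  (2 * pi `^ (n.+2%:R / 2) / Gamma (n.+2%:R / 2))^-1 * stereo_jacobian x =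
  tcauchy_pdf 0 (-1) x.
Proof.
have [G0 _] := Gamma_surface_area R n.
have p0 : pi `^ (n.+2%:R / 2) != 0 :> R by rewrite gt_eqF// powR_gt0 ?pi_gt0.
rewrite /tcauchy_pdf /stereo_jacobian normrN1 sqrrN expr1n subr0.
rewrite -[2 / _]/(2 * _^-1) div1r exprMn mulrA; congr (_ * _).
by rewrite exprS/=; field; rewrite p0 gt_eqF.
Qed.

Lemma sphcauchy_stereo (phi : extR R n.+2) (A : set (extC R n.+1)) :
  measurable A ->
  sphcauchy phi (@stereo R n.+1 @^-1` A) = tcauchy (stereo phi) A.
Proof.
move=> mA; pose B := @sphere R n.+2 `&` Some @^-1` (@stereo R n.+1 @^-1` A).
have mB : measurable B.
  apply: measurableI; first exact: measurable_sphere.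
  by have := @measurable_stereo R n.+1 measurableT A mA; rewrite setTI.
(* In the chart $q$, the spherical event [B] is the event that [tcauchy] measures. *)
have invB : @inv_stereo R n.+1 @^-1` B = [set x | A (Some (x, 0))].
  apply/seteqP; split => x.
    move=> [_ Ax]; have : A (stereo (Some (inv_stereo x))) by exact: Ax.
    by rewrite stereo_inv_stereo.
  move=> Ax; split; first exact: enorm_inv_stereo.
  suff : A (stereo (Some (inv_stereo x))) by [].
  by rewrite stereo_inv_stereo.
have mC : measurable [set x : 'rV[R]_n.+1 | A (Some (x, 0))].
  by rewrite -invB -[X in measurable X]setTI; exact: measurable_inv_stereo.
case: phi => [v|]; last first.
  have [G0 aE] := Gamma_surface_area R n.
  rewrite /sphcauchy -/B aE/= oppr_eq0 oner_eq0 surface_areaE// setTI invB.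
  have mJ : measurable_fun [set x | A (Some (x, 0))]
      (fun x : 'rV[R]_n.+1 => (stereo_jacobian x)%:E).
    by apply/measurable_EFinP/measurable_funTS; exact: measurable_stereo_jacobian.
  have J0 (x : 'rV[R]_n.+1) : [set x | A (Some (x, 0))] x ->
      (0 <= (stereo_jacobian x)%:E)%E.
    by move=> _; rewrite lee_fin stereo_jacobian_ge0.
  set k := (_^-1)%:E; have k0 : (0 <= k)%E.
    by rewrite lee_fin invr_ge0 divr_ge0 ?mulr_ge0 ?powR_ge0// ltW.
  have := ge0_integralZl (lebesgue_rV R n.+1) mC mJ J0 k0 => <-.
  apply: eq_integral => x _.
  by rewrite -EFinM uniform_pdf_inv_stereo.
(* On the sphere both laws are point masses: $\sigma = 0$ away from the north pole, and the north
   pole goes to infinity. *)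
rewrite /sphcauchy; case: ifPn => [/eqP v1|v1].
  rewrite !diracE -[Some v \in _]/(stereo (Some v) \in A).
  rewrite /stereo; case: ifP => // _.
  by rewrite v1 expr1n subrr mul0r /tcauchy eqxx.
(* Off the sphere the image is finite, since the north pole has norm 1, and $\sigma \ne 0$. *)
case vE : (stereo (Some v)) => [[mu s]|]; last first.
  move: vE; rewrite /stereo; case: ifP => // /eqP vN _.
  by move: v1; rewrite vN enorm_north eqxx.
rewrite /tcauchy; have /negbTE -> : s != 0.
  move: vE; rewrite /stereo; case: ifPn => // vN [_ <-].
  apply: mulf_neq0; last by rewrite invr_eq0 gt_eqF// enorm_gt0// subr_eq0.
  by rewrite subr_eq0 eq_sym -[1](expr1n _ 2) eqrXn2 ?enorm_ge0.
(* Restriction to [B] goes into the integrand so that the surface integral can be pulled back to the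
   chart. *)
rewrite -/B integral_mkcond ge0_integral_surface_area; last 2 first.
- apply: (measurable_restrictT _ mB).1; apply: measurable_funTS.
  by apply/measurable_EFinP; exact: measurable_sphcauchy_pdf.
- by apply: erestrict_ge0 => y _; rewrite lee_fin sphcauchy_pdf_ge0.
rewrite [RHS]integral_mkcond -invB; apply: eq_integral => x _.
rewrite !patchE -[x \in _]/(inv_stereo x \in B); case: ifP => _; last by rewrite mul0e.
by rewrite -EFinM (sphcauchy_pdf_inv_stereo _ v1 vE).
Qed.

End cauchy_laws.

Theorem theorem5 (R : realType) (d : nat) (d_ge1 : (1 <= d)%N) :
  (forall (phi : extR R d.+1)
          (dT : measure_display) (T : measurableType dT) (P : probability T R)
          (Y : T -> extR R d.+1),
     dist_sphcauchy P Y phi ->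
     dist_tcauchy P (fun w => stereo (Y w)) (stereo phi)) /\
  (forall (th : extC R d)
          (dT : measure_display) (T : measurableType dT) (P : probability T R)
          (X : T -> extC R d),
     dist_tcauchy P X th ->
     dist_sphcauchy P (fun w => stereo_inv (X w)) (stereo_inv th)).
Proof.
(* Writing $d = n + 1$ puts the sphere in dimension $n + 2$, as in the polar formula. *)
case: d d_ge1 => // n _; split.
  move=> phi dT T P Y [mY YS lawY]; split.
  - exact: (measurableT_comp (@measurable_stereo R n.+1) mY).
  - move=> w; have [y yS <-] := YS w; rewrite /in_extR /=.
    case: ifP => // _; have -> : enorm y = 1 by [].
    by rewrite expr1n subrr mul0r.
  - move=> A mA; rewrite -sphcauchy_stereo// -lawY//.
    by have := @measurable_stereo R n.+1 measurableT A mA; rewrite setTI.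
move=> th dT T P X [mX XS lawX]; split.
- exact: (measurableT_comp (@measurable_stereo_inv R n.+1) mX).
- move=> w; have := XS w; rewrite /in_extR/=; case: (X w) => [[mu s] ->|_].
    by rewrite stereo_inv_real; exists (inv_stereo mu) => //; exact: enorm_inv_stereo.
  by exists (north R n.+1) => //; exact: enorm_north.
- move=> A mA.
  have mA' : measurable (@stereo_inv R n.+1 @^-1` A).
    by have := @measurable_stereo_inv R n.+1 measurableT A mA; rewrite setTI.
  (* The projection is a bijection, so [A] is a preimage under [stereo], and the inverse direction
     follows from the same equality of laws. *)
  have -> : A = @stereo R n.+1 @^-1` (@stereo_inv R n.+1 @^-1` A).
    by apply/seteqP; split => z /=; rewrite stereoK.
  rewrite sphcauchy_stereo// stereo_invK -lawX//.
  by congr (P _); apply/seteqP; split => w /=; rewrite stereoK.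
Qed.
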